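(* For every positive integer $n$ there exist a bijection $p:[n]^{(\geq n/2)}\to[n]^{(\leq n/2)}$ and a partial ordering $<$ on $[n]^{(\geq n/2)}$ such that: (i) $\subset$ is an extension of $<$ on $[n]^{(\geq n/2)}$, i.e. $y<x$ implies $y\subset x$; (ii) if $C\subset[n]^{(\geq n/2)}$ is a chain with respect to $<$, then $C\cup p(C)$ is a rank-symmetric chain in $2^{[n]}$, where $p(C)=\{p(x):x\in C\}$; (iii) the poset $([n]^{(\geq n/2)},<)$ satisfies the normalized matching property.
   Context: $[n]=\{1,\dots,n\}$, $2^{[n]}$ is the power set of $[n]$ ordered by inclusion, $[n]^{(\geq k)}=\{x\subseteq[n]:|x|\geq k\}$ and $[n]^{(\leq k)}=\{x\subseteq[n]:|x|\leq k\}$. A chain $c_0\subset\dots\subset c_k$ in $2^{[n]}$ is rank-symmetric if $|c_i|+|c_{k-i}|=n$ for $i=0,\dots,k$. A poset $P$ is graded if its elements can be partitioned into levels $A_0,\dots,A_m$ where $A_0$ is the set of minimal elements and whenever $x\in A_i$ and $y$ covers $x$ then $y\in A_{i+1}$. A bipartite graph $G=(A,B,E)$ is a normalized matching graph if $|X|/|A|\leq|\Gamma(X)|/|B|$ for every $X\subseteq A$, where $\Gamma(X)$ is the set of neighbours of $X$ in $B$. A graded poset satisfies the normalized matching property if for any two distinct levels $A_i,A_j$, the bipartite comparability graph between $A_i$ and $A_j$ is a normalized matching graph. *)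

(* Defs.v *)
From HB Require Import structures.
From mathcomp Require Import all_boot all_order all_algebra.
Set Implicit Arguments. Unset Strict Implicit. Unset Printing Implicit Defensive.
Import GRing.Theory Num.Theory.

(* [n] is modelled by 'I_n = {0, ..., n-1}.  The threshold k is rational, so
   that k = n/2 makes sense for odd n. *)
Definition sets_ge (n : nat) (k : rat) : {set {set 'I_n}} :=
  [set x : {set 'I_n} | (k <= #|x|%:R)%R].
Definition sets_le (n : nat) (k : rat) : {set {set 'I_n}} :=
  [set x : {set 'I_n} | (#|x|%:R <= k)%R].

Definition upper_half (n : nat) : predArgType :=
  {x : {set 'I_n} | x \in sets_ge n (n%:R / 2%:R)%R}.
Definition lower_half (n : nat) : predArgType :=
  {x : {set 'I_n} | x \in sets_le n (n%:R / 2%:R)%R}.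
HB.instance Definition _ (n : nat) := SubFinite.on (upper_half n).
HB.instance Definition _ (n : nat) := SubFinite.on (lower_half n).

(* s lists the members of S in strictly increasing order; the empty family
   counts as a (vacuously rank-symmetric) chain. *)
Definition rank_symmetric_chain (n : nat) (S : {set {set 'I_n}}) : Prop :=
  exists s : seq {set 'I_n},
    [/\ S = [set x in s],
        sorted (fun x y : {set 'I_n} => x \proper y) s &
        forall i : nat, (i < size s)%N ->
          (#|nth set0 s i| + #|nth set0 s ((size s).-1 - i)|)%N = n].

Definition strict_partial_order (T : Type) (lt : rel T) : Prop :=
  irreflexive lt /\ transitive lt.

Definition comparable_by (T : eqType) (lt : rel T) : rel T :=
  fun x y => [|| x == y, lt x y | lt y x].

Definition is_chain (T : finType) (lt : rel T) (C : {set T}) : Prop :=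
  {in C &, forall x y, comparable_by lt x y}.

(* y covers x, in this argument order *)
Definition covers (T : finType) (lt : rel T) (y x : T) : bool :=
  lt x y && [forall z, ~~ (lt x z && lt z y)].

(* For a finite poset such levels are unique when they exist, since they are
   required to be nonempty.  The last clause forbids covers of elements of the
   top level. *)
Definition is_grading (T : finType) (lt : rel T) (m : nat)
    (A : 'I_m.+1 -> {set T}) : Prop :=
  [/\ forall i, A i != set0,
      forall i j, i != j -> [disjoint A i & A j],
      \bigcup_i A i = [set: T],
      A ord0 = [set x | [forall y, ~~ lt y x]] &
      forall (i : 'I_m.+1) (x y : T), x \in A i -> covers lt y x ->
        exists2 j : 'I_m.+1, j = i.+1 :> nat & y \in A j].

Definition neighbours (T U : finType) (B : {set U}) (E : T -> U -> bool)
    (X : {set T}) : {set U} :=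
  [set b in B | [exists a in X, E a b]].

Definition normalized_matching_graph (T U : finType)
    (A : {set T}) (B : {set U}) (E : T -> U -> bool) : Prop :=
  forall X : {set T}, X \subset A ->
    (#|X|%:R / #|A|%:R <= #|neighbours B E X|%:R / #|B|%:R :> rat)%R.

Definition normalized_matching_property (T : finType) (lt : rel T) : Prop :=
  exists (m : nat) (A : 'I_m.+1 -> {set T}),
    is_grading lt A /\
    forall i j : 'I_m.+1, i != j ->
      normalized_matching_graph (A i) (A j) (comparable_by lt).

(* Main.v *)
Require Import Defs.
From mathcomp Require Import all_boot all_order all_algebra.
From mathcomp Require Import zify.
Set Implicit Arguments. Unset Strict Implicit. Unset Printing Implicit Defensive.
Import Order.TTheory GRing.Theory Num.Theory.

(* Place the ground set on a circle and read the elements of x as opening and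
   the other positions as closing brackets.  If 2|x| >= n, cyclic bracket
   matching leaves exactly 2|x| - n elements of x unmatched and matches
   everything else; let U x be the set of unmatched elements and
   p x = x \ U x, so that |p x| = n - |x|.  Removing u in U x turns u into the
   partner of the preceding unmatched element u', whence p x is contained in
   p (x \ u); the order is generated by these removals.

   For the normalized matching property between consecutive levels, give x one
   mark at each of the n positions and one more at each element of U x, 2|x|
   marks in all.  Send a mark at position s to (y, s), where y = x \ u and u is
   the first unmatched element after s (u = s for an extra mark).  Then s is
   not in U y, and the map is injective because u ends the outermost bracket
   pair of y around s.  Since y offers n - |U y| = 2(n - |y|) values of s,
   |X| k <= |shade X| (n - k + 1) for every family X of k-sets. *)

(** * Prefix counts of a predicate on the naturals *)

Definition cnt (b : pred nat) (t : nat) : nat := \sum_(i < t) b i.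

Lemma cntS (b : pred nat) t : cnt b t.+1 = cnt b t + b t.
Proof. by rewrite /cnt big_ord_recr. Qed.

Lemma leq_cnt (b : pred nat) s t : s <= t -> cnt b s <= cnt b t.
Proof.
elim: t => [|t IH]; first by rewrite leqn0 => /eqP->.
by rewrite leq_eqVlt ltnS cntS => /orP[/eqP->|/IH]; rewrite ?cntS //; lia.
Qed.

Lemma eq_cnt (b b' : pred nat) t : b =1 b' -> cnt b t = cnt b' t.
Proof. by move=> bb'; apply: eq_bigr => i _; rewrite bb'. Qed.

Lemma cnt_periodic (b : pred nat) n : (forall t, b (t + n) = b t) ->
  forall t, cnt b (t + n) = cnt b t + cnt b n.
Proof.
move=> b_per; elim=> [|t IH]; first by rewrite /cnt big_ord0.
by rewrite addSn !cntS IH b_per; lia.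
Qed.

(** Each further member of [b] raises the integer [g] by at least one; this bounds numbers of
    exposed positions by height differences. *)
Lemma cnt_le_strict_mono (b : pred nat) (g : nat -> int) (s t : nat) :
  {in b &, forall i j, i < j -> (g i < g j)%R} -> b s -> b t -> s <= t ->
  ((cnt b t)%:Z - (cnt b s)%:Z <= g t - g s)%R.
Proof.
move=> g_incr bs bt; rewrite leq_eqVlt => /predU1P[->|st]; first lia.
(* [l] is the last member of [b] below [t]; comparing with it lets the induction pass over positions
   outside [b]. *)
suff [l /andP[bl lt_lt] h] : exists2 l, b l && (l < t) &
    ((cnt b t)%:Z - (cnt b s)%:Z <= g l - g s + 1)%R.
  by have := g_incr l t bl bt lt_lt; lia.
elim: t st {bt} => // t IH; rewrite ltnS leq_eqVlt => /predU1P[<-|/IH [l /andP[bl lt_lt] h]].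
  by exists s; rewrite ?bs ?ltnSn // cntS; lia.
case bt: (b t); last by exists l; rewrite ?bl ?cntS ?bt; lia.
exists t; first by rewrite bt /=.
by have := g_incr l t bl bt lt_lt; rewrite cntS bt; lia.
Qed.

(** * Bracket heights and exposed positions of a periodic word *)

Definition height (b : pred nat) (t : nat) : int := ((cnt b t).*2%:Z - t%:Z)%R.

(* With 2|x| >= n the height never decreases over a full period, so comparing
   with the next n positions amounts to comparing with all later ones. *)
Definition exposed (n : nat) (b : pred nat) (t : nat) : bool :=
  all (fun j => (height b t < height b j)%R) (iota t.+1 n).

Lemma heightS b t : height b t.+1 = (height b t + (if b t then 1 else -1))%R.
Proof. by rewrite /height cntS; case: (b t); lia. Qed.

Lemma height_periodic b n : (forall t, b (t + n) = b t) ->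
  forall t, height b (t + n) = (height b t + height b n)%R.
Proof. by move=> b_per t; rewrite /height cnt_periodic //; lia. Qed.

Section Periodic.

Variables (n : nat) (b : pred nat).
Hypothesis n_gt0 : 0 < n.
Hypothesis b_per : forall t, b (t + n) = b t.
Hypothesis b_ge : n <= (cnt b n).*2.

Let heightD := height_periodic b_per.

Lemma height_ge0 : (0 <= height b n)%R.
Proof. by rewrite /height; lia. Qed.

Lemma exposedP t :
  reflect (forall j, t < j -> (height b t < height b j)%R) (exposed n b t).
Proof.
apply: (iffP allP) => h j; last by rewrite mem_iota => /andP[/h].
elim/ltn_ind: j => j IH tj.
have [jn|nj] := leqP j (t + n); first by apply: h; rewrite mem_iota; lia.
have := IH (j - n); have := heightD (j - n); have := height_ge0.
by rewrite subnK; lia.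
Qed.

Lemma exposedD t : exposed n b (t + n) = exposed n b t.
Proof.
apply/exposedP/exposedP => h j tj.
  by have := h (j + n); rewrite !heightD; lia.
have := h (j - n); have := heightD (j - n); have := heightD t.
by rewrite subnK; lia.
Qed.

Lemma exposed_mem t : exposed n b t -> b t.
Proof. by move=> /exposedP/(_ t.+1 (leqnn _)); rewrite heightS; case: (b t) => //; lia. Qed.

(* An exposed position realises the minimum of the height over its future, and
   this future minimum grows by one exactly at exposed positions. *)
Lemma height_exposed_le i t : exposed n b i -> t <= i ->
  (height b i - height b t <=
   (cnt (exposed n b) i)%:Z - (cnt (exposed n b) t)%:Z)%R.
Proof.
move=> ei; have [k] := ubnP (i - t); elim: k t => // k IH t ltk.
rewrite leq_eqVlt => /predU1P[->|ti]; first by lia.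
case et: (exposed n b t).
  have bt := exposed_mem et; have := IH t.+1.
  by rewrite heightS bt cntS et; lia.
(* Some later [j] is no higher than [t]. If [j <= i], induction applies at [j]; otherwise exposure
   of [i] puts it below [j], hence below [t]. *)
have /allPn[j] := negbT et; rewrite mem_iota => tj hj.
have [ji|ij] := leqP j i.
  by have := IH j; have : cnt (exposed n b) t <= cnt (exposed n b) j;
    [apply: leq_cnt|]; lia.
have := exposedP _ ei _ ij; have : cnt (exposed n b) t <= cnt (exposed n b) i;
  [apply: leq_cnt|]; lia.
Qed.

Lemma exposed_exists : (0 < height b n)%R -> exists i, exposed n b i.
Proof.
move=> h_gt0.
(* Lexicographic order by height, shifted by [n] to stay in the naturals, then by decreasing
   position: the minimum is the last lowest position of a period. *)
pose f (i : 'I_n) := ((cnt b i).*2 + n - i) * n.+1 + (n - i).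
have [i _ i_min] := @arg_minnP _ (Ordinal n_gt0) xpredT f isT.
exists i; apply/allP => j; rewrite mem_iota => /andP[ij ji].
have key (j' : 'I_n) : (height b i <= height b j')%R /\
    (i < j' -> (height b i < height b j')%R).
  have := i_min j' isT; rewrite /f /height.
  have := ltn_ord i; have := ltn_ord j'.
  move: (cnt b i) (cnt b j') => ci cj; split; nia.
have [jn|nj] := ltnP j n; first by have [_] := key (Ordinal jn); apply.
have jn : j - n < n by have := ltn_ord i; lia.
have [+ _] := key (Ordinal jn); have := heightD (j - n).
by rewrite subnK //=; lia.
Qed.

(** Over a period starting at an exposed position, [height_exposed_le] bounds the height gain by the
    count, and strict growth along exposed positions gives the converse. With zero gain the height
    recurs, so nothing is exposed. *)
Lemma cnt_exposed : ((cnt (exposed n b) n)%:Z = height b n)%R.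
Proof.
have ED := cnt_periodic exposedD.
have [h0|h_gt0] := eqVneq (height b n) 0%R; last first.
  have [|i ei] := exposed_exists; first by have := height_ge0; lia.
  have ein : exposed n b (i + n) by rewrite exposedD.
  have := height_exposed_le ein (leq_addr _ _); rewrite ED heightD.
  have := @cnt_le_strict_mono _ (height b) i (i + n) _ ei ein (leq_addr _ _).
  rewrite ED heightD => H; have {}H := H (fun i j ei _ => exposedP _ ei j); lia.
rewrite h0 /cnt big1 // => i _; apply/eqP; rewrite eqb0; apply/negP => /exposedP.
by move/(_ (i + n)); rewrite heightD h0; lia.
Qed.

Lemma exposed_after t : (0 < height b n)%R ->
  exists u, [/\ t < u, exposed n b u & forall j, t < j < u -> ~~ exposed n b j].
Proof.
move=> /exposed_exists[i ei].
have ex : exists u, (t < u) && exposed n b u.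
  exists (i + t.+1 * n); apply/andP; split; first by nia.
  by elim: t.+1 => [|k IH]; rewrite ?mul0n ?addn0 // mulSn addnCA addnC exposedD.

have [u /andP[tu eu] u_min] := ex_minnP ex; exists u; split=> // j /andP[tj ju].
by apply/negP => ej; have := u_min j; rewrite tj ej; lia.
Qed.

End Periodic.

(** * Periodic reduction and comparison of the heights of two words *)

Lemma periodic_mod (T : Type) (b : nat -> T) n :
  (forall t, b (t + n) = b t) -> forall t, b (t %% n) = b t.
Proof.
move=> b_per t; rewrite {2}(divn_eq t n) addnC.
by elim: (t %/ n) => [|k IH]; rewrite ?addn0 // mulSn addnCA addnC b_per.
Qed.

Lemma cnt_const (b : pred nat) s t : s <= t ->
  (forall j, s <= j < t -> ~~ b j) -> cnt b t = cnt b s.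
Proof.
elim: t => [|t IH]; first by rewrite leqn0 => /eqP->.
rewrite leq_eqVlt ltnS => /predU1P[->//|st nb]; rewrite cntS IH //.
  by rewrite (negPf (nb t _)) ?addn0 // st /=.
by move=> j /andP[sj jt]; apply: nb; rewrite sj ltnW.
Qed.

Lemma height_agree (b b' : pred nat) s t : s <= t ->
  (forall j, s <= j < t -> b j = b' j) ->
  (height b t - height b s = height b' t - height b' s)%R.
Proof.
elim: t => [|t IH]; first by rewrite leqn0 => /eqP->; rewrite !subrr.
rewrite leq_eqVlt ltnS => /predU1P[->|st bb']; first by rewrite !subrr.
have := IH st; rewrite !heightS bb' ?st ?ltnSn // => {}IH.
suff : forall j, s <= j < t -> b j = b' j by move/IH; lia.
by move=> j jst; apply: bb'; lia.
Qed.

Lemma height_sub (b b' : pred nat) s t : s <= t -> subpred b b' ->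
  (height b t - height b s <= height b' t - height b' s)%R.
Proof.
move=> st sub; elim: t st => [|t IH]; first by rewrite leqn0 => /eqP->; rewrite !subrr.
rewrite leq_eqVlt ltnS => /predU1P[->|/IH]; first by rewrite !subrr.
by rewrite !heightS; have := sub t; case: (b t) => [->|_] //; case: (b' t); lia.
Qed.

(** * Cyclic bracket matching of a set, and injectivity of its matched part *)

Section Cyclic.

Variable N : nat.
Local Notation n := N.+1.
Implicit Types x y z : {set 'I_n}.

(** A periodic word on the naturals, so that cyclic intervals become ordinary ones. *)
Definition unroll x : pred nat := fun t => inZp t \in x.

Lemma unrollD x t : unroll x (t + n) = unroll x t.
Proof. by rewrite /unroll; congr (_ \in x); apply: val_inj; rewrite /= modnDr. Qed.

Lemma unroll_ord x (i : 'I_n) : unroll x i = (i \in x).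
Proof. by rewrite /unroll valZpK. Qed.

Lemma cnt_unroll x : cnt (unroll x) n = #|x|.
Proof.
rewrite -sum1_card big_mkcond; apply: eq_bigr => i _ /=.
by rewrite unroll_ord; case: (i \in x).
Qed.

Lemma height_unroll x : height (unroll x) n = (#|x|.*2%:Z - n%:Z)%R.
Proof. by rewrite /height cnt_unroll. Qed.

Lemma unrollS x y : x \subset y -> subpred (unroll x) (unroll y).
Proof. by move=> /subsetP xy t; apply: xy. Qed.

Definition unmatched x : {set 'I_n} := [set i : 'I_n | exposed n (unroll x) i].

Definition matched x : {set 'I_n} := x :\: unmatched x.

Section Heavy.

Variable x : {set 'I_n}.
Hypothesis x_ge : n <= #|x|.*2.

Let cnt_ge : n <= (cnt (unroll x) n).*2. Proof. by rewrite cnt_unroll. Qed.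

Lemma unroll_unmatched : unroll (unmatched x) =1 exposed n (unroll x).
Proof.
by move=> t; rewrite /unroll inE /= periodic_mod // => j; apply/exposedD/cnt_ge/unrollD.
Qed.

Lemma card_unmatched : #|unmatched x| = #|x|.*2 - n.
Proof.
have := cnt_exposed (ltn0Sn N) (unrollD x) cnt_ge.
by rewrite height_unroll -(eq_cnt _ unroll_unmatched) cnt_unroll; lia.
Qed.

Lemma unmatched_sub : unmatched x \subset x.
Proof.
apply/subsetP => i; rewrite inE -unroll_ord.
exact: exposed_mem (ltn0Sn N) (unrollD x) cnt_ge _.
Qed.

Lemma card_matched : #|matched x| + #|x| = n.
Proof.
have := cardsID (unmatched x) x; rewrite (setIidPr unmatched_sub) card_unmatched.
by rewrite -/(matched x); lia.
Qed.

Lemma matched_sub : matched x \subset x. Proof. exact: subsetDl. Qed.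

Lemma matchedU : matched x :|: unmatched x = x.
Proof. by rewrite setUC -{1}(setIidPr unmatched_sub) setID. Qed.

Lemma height_matched t : (height (unroll (matched x)) t =
  height (unroll x) t - (cnt (exposed n (unroll x)) t).*2%:Z)%R.
Proof.
elim: t => [|t IH]; first by rewrite /height /cnt !big_ord0.
rewrite !heightS cntS IH -unroll_unmatched /unroll !inE.
have /implyP := subsetP unmatched_sub (inZp t); rewrite inE.
by case: (exposed _ _ _) => /=; case: (_ \in x) => //= _; lia.
Qed.

(** The height of [x] gains at most the number of exposed positions passed, and closing each of them
    costs two. So they mark record lows of the height of [matched x]. *)
Lemma height_matched_lt t j : exposed n (unroll x) j -> t <= j ->
  (height (unroll (matched x)) j.+1 < height (unroll (matched x)) t)%R.
Proof.
move=> ej tj; have := height_exposed_le (ltn0Sn N) (unrollD x) cnt_ge ej tj.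
rewrite !height_matched heightS cntS ej.
rewrite (exposed_mem (ltn0Sn N) (unrollD x) cnt_ge ej).
have := leq_cnt (exposed n (unroll x)) tj; lia.
Qed.

End Heavy.

Lemma unmatchedS x y : n <= #|x|.*2 -> x \subset y -> unmatched x \subset unmatched y.
Proof.
move=> x_ge xy; apply/subsetP => i; rewrite !inE => /allP ei; apply/allP => j jI.
have := ei j jI; move: jI; rewrite mem_iota => /andP[ij _].
by have := height_sub (ltnW ij) (unrollS xy); lia.
Qed.

(** Both unmatched sets mark record lows of the same height, which falls by [2|x| - n] per period.
    Their union thus has at most that many elements, the size of each. *)
Lemma matched_inj x x' : n <= #|x|.*2 -> n <= #|x'|.*2 ->
  matched x = matched x' -> x = x'.
Proof.
move=> x_ge x'_ge xx'.
have card_eq : #|x| = #|x'|.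
  by have := card_matched x_ge; have := card_matched x'_ge; rewrite xx'; lia.
suff UU' : unmatched x = unmatched x'.
  by rewrite -(matchedU x_ge) -(matchedU x'_ge) xx' UU'.
have card_leU : #|unmatched x :|: unmatched x'| <= #|x|.*2 - n.
  have [->|[i]] := set_0Vmem (unmatched x :|: unmatched x'); first by rewrite cards0.
  rewrite -unroll_ord => iU.
  set P := unroll (unmatched x :|: unmatched x') in iU *.
  have PE t : P t = exposed n (unroll x) t || exposed n (unroll x') t.
    by rewrite -!unroll_unmatched // /P /unroll inE.
  have iUn : P (i + n) by rewrite /P unrollD.
  (* The record low is reached just after the position, hence [t.+1]. *)
  pose g t := (- height (unroll (matched x)) t.+1)%R.
  have g_incr : {in P &, forall s t, s < t -> (g s < g t)%R}.
    move=> s t _; rewrite /g -[t \in P]/(P t) PE => /orP[] et st.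
      by have := height_matched_lt x_ge et st; lia.
    by have := height_matched_lt x'_ge et st; rewrite xx'; lia.
  have := @cnt_le_strict_mono P g _ _ g_incr iU iUn (leq_addr _ _).
  rewrite (cnt_periodic (unrollD _)) cnt_unroll /g /P -addSn.
  by rewrite (height_periodic (unrollD _)) height_unroll; have := card_matched x_ge; lia.
have UE : unmatched x = unmatched x :|: unmatched x'.
  by apply/eqP; rewrite eqEcard subsetUl /= card_unmatched.
have UE' : unmatched x' = unmatched x :|: unmatched x'.
  by apply/eqP; rewrite eqEcard subsetUr /= card_unmatched // -card_eq.
by rewrite UE -UE'.
Qed.

End Cyclic.

(** * Effect of removing one unmatched element *)

Section Removal.

Variable N : nat.
Local Notation n := N.+1.
Variables (x : {set 'I_n}) (u : nat).
Hypothesis x_ge : n.+2 <= #|x|.*2.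
Hypothesis eu : exposed n (unroll x) u.

Let y := x :\ inZp u.
Let x_ge' : n <= #|x|.*2. Proof. by move: x_ge; lia. Qed.
Let cx_ge : n <= (cnt (unroll x) n).*2. Proof. by rewrite cnt_unroll. Qed.
Let xu : unroll x u. Proof. exact (exposed_mem (ltn0Sn N) (unrollD x) cx_ge eu). Qed.

Lemma card_removal : #|x| = #|y|.+1.
Proof. by rewrite (cardsD1 (inZp u) x) [inZp u \in x]xu. Qed.

Let y_ge : n <= #|y|.*2. Proof. by move: x_ge; rewrite card_removal; lia. Qed.
Let cy_ge : n <= (cnt (unroll y) n).*2. Proof. by rewrite cnt_unroll. Qed.

Lemma unroll_removal j : j != u %[mod n] -> unroll x j = unroll y j.
Proof. by move=> ju; rewrite /unroll !inE -val_eqE /= ju. Qed.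

Lemma unroll_removal_after j : u < j < u + n -> unroll x j = unroll y j.
Proof.
move=> /andP[uj jun]; apply: unroll_removal.
by rewrite eqn_mod_dvd 1?ltnW // gtnNdvd //; lia.
Qed.

Lemma unroll_removal_before j : j < u < j + n -> unroll x j = unroll y j.
Proof.
move=> /andP[uj jun]; apply: unroll_removal.
by rewrite eq_sym eqn_mod_dvd 1?ltnW // gtnNdvd //; lia.
Qed.

Lemma height_removalS : height (unroll y) u.+1 = (height (unroll y) u - 1)%R.
Proof. by rewrite heightS /unroll !inE eqxx. Qed.

(** Up to [u + n] the heights of [x] and [y] change alike after [u], where [x] is exposed; further
    on, the height of [y] does not decrease over a period. *)
Lemma height_removal_min i : u < i ->
  (height (unroll y) u.+1 <= height (unroll y) i)%R.
Proof.
elim/ltn_ind: i => i IH ui.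
have [iun|uni] := leqP i (u + n).
  have := exposedP (ltn0Sn N) (unrollD x) cx_ge _ eu _ ui.
  have near j : u < j < i -> unroll x j = unroll y j.
    by move=> uji; apply: unroll_removal_after; lia.
  by have := height_agree ui near; rewrite [height (unroll x) u.+1]heightS xu; lia.
have := IH (i - n); have := height_periodic (unrollD y) (i - n).
have := height_ge0 (ltn0Sn N) cy_ge; rewrite subnK; lia.
Qed.

Section Before.

Variable t : nat.
Hypothesis tu : t < u.
Hypothesis gap : forall j, t < j < u -> ~~ exposed n (unroll x) j.

Let cnt_gap j : t < j <= u ->
  cnt (exposed n (unroll x)) u = cnt (exposed n (unroll x)) j.
Proof.
by move=> /andP[tj ju]; apply: cnt_const => // i /andP[ji iu]; apply: gap; rewrite iu (leq_trans tj).
Qed.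

(** A period contains at least two unmatched positions, whereas only [t] can be one among
    [t, ..., u - 1]. *)
Let unT : u < t + n.
Proof.
rewrite ltnNge; apply/negP => /(leq_cnt (exposed n (unroll x))).
rewrite (@cnt_gap t.+1) ?ltnSn // cntS cnt_periodic; last first.
  exact: exposedD (ltn0Sn N) (unrollD x) cx_ge.
rewrite -(eq_cnt n (unroll_unmatched x_ge')) cnt_unroll card_unmatched //.
by case: (exposed _ _ _); move: x_ge; lia.
Qed.

Let height_before i : t <= i <= u ->
  (height (unroll y) u - height (unroll y) i =
   height (unroll x) u - height (unroll x) i)%R.
Proof.
move=> /andP[ti iu]; apply: height_agree => // j /andP[ij ju].
by rewrite (@unroll_removal_before j) // ju /=; lia.
Qed.

(** With no exposed position in between, the height does not rise from [j.+1] to [u], and in [y] it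
    drops at [u]. *)
Lemma height_removal_lt j : t <= j < u ->
  (height (unroll y) u.+1 < height (unroll y) j.+1)%R.
Proof.
move=> /andP[tj ju]; have := @height_before j.+1.
have := height_exposed_le (ltn0Sn N) (unrollD x) cx_ge eu ju.
by rewrite (@cnt_gap j.+1) ?height_removalS; lia.
Qed.

(** From [t] to [u] the height gains at most one, and that only if [t] is exposed in [x]; the drop
    at [u] cancels the gain. *)
Lemma exposed_removal : ~~ exposed n (unroll y) t.
Proof.
apply/negP => /(exposedP (ltn0Sn N) (unrollD y) cy_ge _)/(_ u.+1).
have := height_exposed_le (ltn0Sn N) (unrollD x) cx_ge eu (ltnW tu).
rewrite (@cnt_gap t.+1) ?ltnSn // cntS height_removalS.
have := @height_before t; case: (exposed _ _ _); lia.
Qed.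

End Before.

Lemma exposed_removed : ~~ exposed n (unroll y) u.
Proof.
apply/negP => /(exposed_mem (ltn0Sn N) (unrollD y) cy_ge).
by rewrite /unroll !inE eqxx.
Qed.

End Removal.

(** * The injection of marks between consecutive levels *)

Section Matching.

Variable N : nat.
Local Notation n := N.+1.

(* The removed position is read off the smaller set y: it is the first position
   from s on after which the height of y takes a minimum over its future. *)
Lemma removal_unique (x x' y : {set 'I_n}) s u u' :
  n.+2 <= #|x|.*2 -> n.+2 <= #|x'|.*2 ->
  exposed n (unroll x) u -> exposed n (unroll x') u' ->
  s <= u -> s <= u' ->
  (forall j, s < j < u -> ~~ exposed n (unroll x) j) ->
  (forall j, s < j < u' -> ~~ exposed n (unroll x') j) ->
  x :\ inZp u = y -> x' :\ inZp u' = y -> u = u'.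
Proof.
wlog uu' : x x' u u' / u < u'.
  move=> H x_ge x'_ge eu eu' su su' gap gap' xy x'y.
  case: (ltngtP u u') => // [uu'|u'u]; first exact: (H x x').
  by apply/esym; apply: (H x' x).
move=> x_ge x'_ge eu eu' su su' gap gap' xy x'y.
(* Seen from [x], [y] is no lower after [u'] than after [u]; seen from [x'], it is strictly
   lower. *)
have := height_removal_min x_ge eu (ltnW uu' : u < u'.+1).
have su'' : s < u' by exact: leq_ltn_trans su uu'.
have := @height_removal_lt N x' u' x'_ge eu' s su'' gap' u.
by rewrite su uu' xy x'y => /(_ isT); lia.
Qed.

(** Both sides are counted doubled: [D] holds the marks of [X], [E] the places offered by [Y], and
    [F] injects [D] into [E]. *)
Lemma card_removals (k : nat) (X Y : {set {set 'I_n}}) :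
  n.+2 <= k.*2 -> (forall x, x \in X -> #|x| = k) ->
  (forall y, y \in Y -> #|y|.+1 = k) ->
  (forall x (i : 'I_n), x \in X -> i \in unmatched x -> x :\ i \in Y) ->
  #|X| * k <= #|Y| * (n.+1 - k).
Proof.
move=> k_ge Xk Yk XY.
(* Each [x] carries [n + #|unmatched x| = 2 * #|x|] marks: every position, and
   once more every unmatched one. *)
pose D := [set w : {set 'I_n} * ('I_n * bool) |
  (w.1 \in X) && (w.2.2 ==> (w.2.1 \in unmatched w.1))].
pose E := [set v : {set 'I_n} * 'I_n | (v.1 \in Y) && (v.2 \in ~: unmatched v.1)].
have cardD : #|D| = #|X| * k.*2.
  rewrite -sum1dep_card -(pair_big_dep (mem X)
    (fun x v => v.2 ==> (v.1 \in unmatched x)) (fun _ _ => 1)) /=.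
  rewrite -sum_nat_const; apply: eq_bigr => x xX.
  rewrite -(pair_big_dep xpredT (fun i e => e ==> (i \in unmatched x))
    (fun _ _ => 1)) /=.
  under eq_bigr do rewrite big_mkcond big_bool /=.
  rewrite big_split /= sum1_card card_ord -big_mkcond sum1_card.
  by rewrite card_unmatched (Xk x xX); lia.
have cardE : #|E| = #|Y| * (n.+1 - k).*2.
  rewrite -sum1dep_card -(pair_big_dep (mem Y)
    (fun y i => i \in ~: unmatched y) (fun _ _ => 1)) /=.
  rewrite -sum_nat_const; apply: eq_bigr => y yY; rewrite sum1_card.
  have := cardsC (unmatched y); rewrite card_ord card_unmatched; last first.
    by have := Yk y yY; lia.
  move: (#|~: _|) => c; have := Yk y yY; lia.
suff : #|D| <= #|E| by rewrite cardD cardE; lia.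
have x_ge x : x \in X -> n.+2 <= #|x|.*2 by move/Xk->.
(* [f w] is the position removed for the mark [w], a natural since it may lie beyond the period; it
   equals [w.2.1] exactly for extra marks. Outside [D] the value 0 is a dummy. *)
have /fin_all_exists[f fP] : forall w : {set 'I_n} * ('I_n * bool), exists u : nat,
    w \in D -> [/\ w.2.1 <= u, (u == w.2.1) = w.2.2, exposed n (unroll w.1) u &
      forall j, w.2.1 < j < u -> ~~ exposed n (unroll w.1) j].
  move=> [x [s e]] /=; case: (boolP (_ \in D)); last by exists 0.
  rewrite inE /= => /andP[xX]; case: e => /= se.
    by exists s; split; rewrite ?eqxx //; [move: se; rewrite inE | lia].
  have cx : n <= (cnt (unroll x) n).*2 by rewrite cnt_unroll; have := x_ge x xX; lia.
  have [|u [su eu gap]] := @exposed_after n _ (ltn0Sn N) (unrollD x) cx s.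
    by rewrite height_unroll; have := x_ge x xX; lia.
  by exists u; split=> //; [lia | apply/eqP; lia].
pose F w := (w.1 :\ (inZp (f w) : 'I_n), w.2.1).
have F_inj : {in D &, injective F}.
  move=> [x [s e]] [x' [s' e']] wD wD' [xx' /= ss']; subst s'.
  have [su us eu gap] := fP _ wD; have [su' us' eu' gap'] := fP _ wD'.
  have [/= xX xX'] : x \in X /\ x' \in X.
    by move: wD wD'; rewrite !inE /= => /andP[? _] /andP[? _].
  have ff' := removal_unique (x_ge _ xX) (x_ge _ xX') eu eu' su su' gap gap' xx' erefl.
  have {xx'} xx' : x = x'.
    have cx z : z \in X -> n <= (cnt (unroll z) n).*2.
      by rewrite cnt_unroll => /x_ge; lia.
    have ux := exposed_mem (ltn0Sn N) (unrollD x) (cx _ xX) eu.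
    have ux' := exposed_mem (ltn0Sn N) (unrollD x') (cx _ xX') eu'.
    by rewrite -(setD1K ux) -(setD1K ux') xx' ff'.
  by rewrite /= in us us'; rewrite xx' -us -us' ff'.
rewrite -(card_in_imset F_inj); apply/subset_leq_card/subsetP => _ /imsetP[w wD ->].
have [su us eu gap] := fP w wD.
have xX : w.1 \in X by move: wD; rewrite inE => /andP[].
rewrite !inE /=; apply/andP; split.
  apply: XY => //; rewrite -[_ \in _]/(unroll (unmatched w.1) (f w)).
  by rewrite unroll_unmatched //; have := x_ge _ xX; lia.
(* An extra mark sits at the removed position itself; an ordinary one lies strictly before it. *)
have [->|neq] := eqVneq (val w.2.1) (f w); first exact: exposed_removed (x_ge _ xX) eu.
apply: exposed_removal (x_ge _ xX) eu _ _ gap => //.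
by rewrite ltn_neqAle neq.
Qed.

End Matching.

(** * Halves, symmetric chains and matching graphs in terms of natural numbers *)

Lemma mem_sets_ge n (x : {set 'I_n}) :
  (x \in sets_ge n (n%:R / 2%:R)%R) = (n <= #|x|.*2).
Proof. by rewrite inE ler_pdivrMr ?ltr0n // -natrM ler_nat muln2. Qed.

Lemma mem_sets_le n (x : {set 'I_n}) :
  (x \in sets_le n (n%:R / 2%:R)%R) = (#|x|.*2 <= n).
Proof. by rewrite inE ler_pdivlMr ?ltr0n // -natrM ler_nat muln2. Qed.

(** The sizes form a strictly increasing list closed under [k -> n - k], which therefore equals its
    own reversed complement. *)
Lemma rank_symmetric_chain_of_total n (S : {set {set 'I_n}}) :
  (forall a b, a \in S -> b \in S -> (a \subset b) || (b \subset a)) ->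
  (forall a, a \in S -> exists2 b, b \in S & #|a| + #|b| = n) ->
  rank_symmetric_chain S.
Proof.
move=> S_tot S_sym; pose le (a b : {set 'I_n}) := a \subset b.
pose s := sort le (enum S).
have memS a : (a \in s) = (a \in S) by rewrite mem_sort mem_enum.
have s_sorted : sorted (fun a b : {set 'I_n} => a \proper b) s.
  apply: pairwise_sorted.
  have : pairwise [rel a b | le a b && (a != b)] s.
    rewrite pairwise_relI -uniq_pairwise sort_uniq enum_uniq andbT.
    rewrite -sorted_pairwise; last by move=> ? ? ?; apply: subset_trans.
    apply: (sort_sorted_in (P := mem S)); last by apply/allP => a; rewrite mem_enum.
    by move=> a b; apply: S_tot.
  by apply: sub_pairwise => a b /= /andP[ab nab]; rewrite properEneq nab.
pose L := [seq #|pred_of_set a| | a <- s].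
have card_le (a : {set 'I_n}) : #|a| <= n by have := max_card (mem a); rewrite card_ord.
have L_sorted : sorted ltn L.
  by rewrite sorted_map; apply: sub_sorted s_sorted => a b /proper_card.
have L_sym : L = [seq n - k | k <- rev L].
  apply: (irr_sorted_eq ltn_trans ltnn) => //.
    rewrite sorted_map rev_sorted /L sorted_map.
    by apply: sub_sorted s_sorted => a b /proper_card ab; apply: ltn_sub2l (ab); apply: leq_trans (ab) _.
  move=> k; apply/mapP/mapP => [[a]|[l]].
    rewrite memS => /S_sym[b bS ab] ->; exists #|b|; last by lia.
    by rewrite mem_rev map_f // memS.
  rewrite mem_rev => /mapP[a]; rewrite memS => /S_sym[b bS ab] -> ->.
  by exists b; rewrite ?memS //; lia.
have size_L : size L = size s by rewrite size_map.
exists s; split=> // [|i i_s]; first by apply/setP => a; rewrite inE memS.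
rewrite -!(nth_map set0 0 (fun a : {set 'I_n} => #|a|)) -/L; [|lia..].
rewrite {1}L_sym (nth_map 0) ?size_rev ?size_L // nth_rev ?size_L //.
have -> : size s - i.+1 = (size s).-1 - i by lia.
by rewrite subnK // (nth_map set0) ?card_le //; lia.
Qed.

Lemma normalized_matching_graph_nat (T U : finType) (A : {set T}) (B : {set U})
    (E : T -> U -> bool) : A != set0 -> B != set0 ->
  (forall X : {set T}, X \subset A -> #|X| * #|B| <= #|neighbours B E X| * #|A|) ->
  normalized_matching_graph A B E.
Proof.
rewrite -!card_gt0 => A_gt0 B_gt0 h X /h.
rewrite ler_pdivrMr ?ltr0n // mulrAC ler_pdivlMr ?ltr0n //.
by rewrite -!natrM ler_nat.
Qed.

(** * The bijection and the order on the upper half *)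

Section HalfOrder.

Variable N : nat.
Local Notation n := N.+1.
Implicit Types x y z : upper_half n.

Lemma upper_halfP x : n <= #|val x|.*2.
Proof. by rewrite -mem_sets_ge (valP x). Qed.

Lemma matched_lower x : matched (val x) \in sets_le n (n%:R / 2%:R)%R.
Proof.
have := card_matched (upper_halfP x); have := upper_halfP x.
by rewrite mem_sets_le; lia.
Qed.

Definition half_map x : lower_half n := Sub (matched (val x)) (matched_lower x).

(** Injectivity suffices, since complementation embeds the lower half into the upper half. *)
Lemma half_map_bij : bijective half_map.
Proof.
have half_map_inj : injective half_map.
  move=> x y /(congr1 val) /= xy; apply: val_inj.
  exact: matched_inj (upper_halfP x) (upper_halfP y) xy.
apply: (inj_card_bij half_map_inj).
have cU (y : lower_half n) : ~: val y \in sets_ge n (n%:R / 2%:R)%R.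
  have := cardsC (val y); have := valP y.
  by rewrite mem_sets_ge mem_sets_le card_ord; lia.
pose g (y : lower_half n) : upper_half n := Sub (~: val y) (cU y).
have g_inj : injective g.
  by move=> y z /(congr1 val) /= /setC_inj yz; apply: val_inj.
exact (leq_card g g_inj).
Qed.

Definition half_step y x : bool :=
  [exists i in unmatched (val x), val y == val x :\ i].

Definition half_lt y x : bool := (y != x) && connect half_step y x.

(** By [unmatchedS] nothing newly becomes unmatched in the smaller set, and the removed element was
    unmatched; so matched elements stay matched. *)
Lemma half_stepP y x : half_step y x ->
  [/\ val y \subset val x, matched (val x) \subset matched (val y) &
      #|val x| = #|val y|.+1].
Proof.
case/exists_inP => i ix /eqP yx; have sub : val y \subset val x by rewrite yx subsetDl.
split=> //; last first.
  by rewrite yx (cardsD1 i (val x)) (subsetP (unmatched_sub (upper_halfP x))).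
apply/subsetP => e; rewrite !inE => /andP[ne ex].
rewrite yx !inE ex andbT -yx; apply/andP; split.
  by have := subsetP (unmatchedS (upper_halfP y) sub) e; rewrite !inE => /contra/(_ ne).
by apply: contraNneq ne => ->; rewrite inE in ix.
Qed.

Lemma connect_half_step y x : connect half_step y x ->
  val y \subset val x /\ matched (val x) \subset matched (val y).
Proof.
case/connectP => s; elim: s y => [|z s IH] y /=; first by move=> _ ->.
case/andP => /half_stepP[yz zy _] /IH h /h[zx xz].
by split; [apply: subset_trans yz zx | apply: subset_trans xz zy].
Qed.

Lemma half_lt_proper y x : half_lt y x -> val y \proper val x.
Proof.
case/andP => yx /connect_half_step[sub _].
by rewrite properEneq sub andbT (inj_eq val_inj).
Qed.

Lemma half_lt_card y x : half_lt y x -> #|val y| < #|val x|.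
Proof. by move/half_lt_proper/proper_card. Qed.

Lemma half_step_lt y x : half_step y x -> half_lt y x.
Proof.
move=> yx; rewrite /half_lt connect1 // andbT.
by apply/eqP => E; have [_ _] := half_stepP yx; rewrite E; lia.
Qed.

Lemma half_lt_strict_partial_order : strict_partial_order half_lt.
Proof.
split=> [x|y x z xy yz]; first by rewrite /half_lt eqxx.
rewrite /half_lt; apply/andP; split.
  by apply/eqP => E; move: (half_lt_card xy) (half_lt_card yz); rewrite E; lia.
by move: xy yz => /andP[_ xy] /andP[_ yz]; apply: connect_trans xy yz.
Qed.

(** The first step of a path from [x] to [y] must already reach [y], or it would lie strictly
    between. *)
Lemma half_covers y x : covers half_lt y x -> half_step x y.
Proof.
case/andP => /andP[ne /connectP[s]]; case: s => [|z s] /=.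
  by move=> _ E; rewrite E eqxx in ne.
case/andP => xz zs yE /forallP/(_ z); rewrite half_step_lt //=.
rewrite /half_lt negb_and negbK => /orP[/eqP <- //|/negP[]].
by apply/connectP; exists s.
Qed.

Lemma half_step_exists x : n.+2 <= #|val x|.*2 -> exists y, half_step y x.
Proof.
move=> x_ge; have : 0 < #|unmatched (val x)|.
  by rewrite (card_unmatched (upper_halfP x)); lia.
case/card_gt0P => i ix.
have yU : val x :\ i \in sets_ge n (n%:R / 2%:R)%R.
  rewrite mem_sets_ge; have := subsetP (unmatched_sub (upper_halfP x)) _ ix.
  by move=> ix'; move: x_ge; rewrite (cardsD1 i) ix'; lia.
by exists (Sub (val x :\ i) yU); apply/exists_inP; exists i; rewrite //= eqxx.
Qed.

Lemma half_rank_symmetric_chain (C : {set upper_half n}) : is_chain half_lt C ->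
  rank_symmetric_chain ([set val x | x in C] :|: [set val (half_map x) | x in C]).
Proof.
move=> C_chain; apply: rank_symmetric_chain_of_total => [a b|a]; last first.
  case/setUP => /imsetP[x xC ->]; have := card_matched (upper_halfP x) => xE.
    by exists (matched (val x)); [apply/setUP; right; apply/imsetP; exists x|rewrite addnC].
  by exists (val x); [apply/setUP; left; apply: imset_f|].
have conn x y : x \in C -> y \in C -> connect half_step x y \/ connect half_step y x.
  move=> xC yC; case/or3P: (C_chain x y xC yC) => [/eqP ->|/andP[_]|/andP[_]]; auto.
(* If [x] is below [y], the inclusions run through [matched (val x)], otherwise through [val y]. *)
have mixed x y : x \in C -> y \in C -> matched (val y) \subset val x.
  move=> xC yC; case: (conn x y xC yC) => /connect_half_step[s m].
    exact: subset_trans m (matched_sub _).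
  exact: subset_trans (matched_sub _) s.
case/setUP=> /imsetP[x xC ->] /setUP[] /imsetP[y yC ->] /=.
- by case: (conn x y xC yC) => /connect_half_step[-> _]; rewrite ?orbT.
- by rewrite mixed ?orbT.
- by rewrite mixed.
- by case: (conn x y xC yC) => /connect_half_step[_ ->]; rewrite ?orbT.
Qed.

(** * Levels, shades and the normalized matching property *)

Definition level k : {set upper_half n} := [set x : upper_half n | #|val x| == k].

Lemma card_level k : n <= k.*2 -> #|level k| = 'C(n, k).
Proof.
move=> k_ge; have := card_draws 'I_n k; rewrite card_ord => <-.
rewrite -(card_imset _ val_inj).
apply: eq_card => a; rewrite inE; apply/imsetP/idP => [[x]|/eqP ak].
  by rewrite inE => xk ->.
have aU : a \in sets_ge n (n%:R / 2%:R)%R by rewrite mem_sets_ge ak.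
by exists (Sub a aU); rewrite ?inE /= ?ak.
Qed.

Lemma level_gt0 k : n <= k.*2 -> k <= n -> 0 < #|level k|.
Proof. by move=> k_ge kn; rewrite card_level // bin_gt0. Qed.

(** The reflexive [connect] makes a family part of its shade on its own level, the base case of
    [card_shade]. *)
Definition shade k (X : {set upper_half n}) : {set upper_half n} :=
  [set y : upper_half n in level k | [exists x in X, connect half_step y x]].

(** The mark count gives the factors [k + 1] and [n - k], which are in the ratio of the two binomial
    level sizes. *)
Lemma card_shadeS k (X : {set upper_half n}) : n <= k.*2 -> k < n ->
  X \subset level k.+1 -> #|X| * #|level k| <= #|shade k X| * #|level k.+1|.
Proof.
move=> k_ge kn /subsetP X_lev.
have : #|X| * k.+1 <= #|shade k X| * (n - k).
  rewrite -(card_imset X val_inj) -(card_imset (shade k X) val_inj) -subSS.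
  apply: card_removals; first by lia.
  - by move=> _ /imsetP[x /X_lev + ->]; rewrite inE => /eqP.
  - by move=> _ /imsetP[y + ->]; rewrite !inE => /andP[/eqP -> _].
  move=> _ i /imsetP[x xX ->] ix.
  have iX := subsetP (unmatched_sub (upper_halfP x)) i ix.
  have ck : #|val x :\ i| = k.
    by have := X_lev x xX; rewrite inE (cardsD1 i) iX => /eqP[].
  have yU : val x :\ i \in sets_ge n (n%:R / 2%:R)%R by rewrite mem_sets_ge ck.
  apply/imsetP; exists (Sub (val x :\ i) yU) => //; rewrite !inE /= ck eqxx /=.
  apply/exists_inP; exists x => //; apply: connect1.
  by apply/exists_inP; exists i; rewrite //= eqxx.
rewrite !card_level //; last by lia.
have := mul_bin_left n k; have : 0 < n - k by lia.
by move: ('C(n, k)) ('C(n, k.+1)) #|X| #|shade k X| (n - k) => *; nia.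
Qed.

(** Density bounds for successive levels multiply, and the intermediate level size cancels. *)
Lemma card_shade k d (X : {set upper_half n}) : n <= k.*2 -> k + d <= n ->
  X \subset level (k + d) -> #|X| * #|level k| <= #|shade k X| * #|level (k + d)|.
Proof.
move=> k_ge; elim: d X => [|d IH] X.
  rewrite addn0 => _ XL; rewrite leq_mul2r; apply/orP; right.
  apply/subset_leq_card/subsetP => x xX; rewrite inE (subsetP XL) //=.
  by apply/exists_inP; exists x.
rewrite addnS => kd XL; pose X' := shade (k + d) X.
have X'L : X' \subset level (k + d) by apply/subsetP => x; rewrite inE => /andP[].
have := card_shadeS _ kd XL; have := IH X' (ltnW kd) X'L.
have : #|shade k X'| <= #|shade k X|.
  apply/subset_leq_card/subsetP => y; rewrite inE => /andP[yk /exists_inP[z zX' yz]].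
  move: zX'; rewrite !inE => /andP[_ /exists_inP[x xX zx]].
  rewrite inE in yk; rewrite yk; apply/exists_inP; exists x => //.
  exact: connect_trans yz zx.
have : 0 < #|level (k + d)| by apply: level_gt0; lia.
rewrite -/X'; move: #|X| #|X'| #|shade k X| #|shade k X'| #|level k|.
move: #|level (k + d)| #|level (k + d).+1| => a b c e f g h a0 gf H1 H2.
have {}H2 : c * a <= e * b by apply: H2; lia.
rewrite -(leq_pmul2l a0).
have : c * a * h <= e * b * h by rewrite leq_mul2r H2 orbT.
have : e * h * b <= g * a * b by rewrite leq_mul2r H1 orbT.
have : g * a * b <= f * a * b by rewrite !leq_mul2r gf !orbT.
by lia.
Qed.

Lemma half_matching_down k d : n <= k.*2 -> k + d <= n ->
  normalized_matching_graph (level (k + d)) (level k) (comparable_by half_lt).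
Proof.
move=> k_ge kd; apply: normalized_matching_graph_nat.
- by rewrite -card_gt0 level_gt0 //; lia.
- by rewrite -card_gt0 level_gt0 //; lia.
move=> X /(card_shade k_ge kd)/leq_trans; apply; rewrite leq_mul2r; apply/orP; right.
apply/subset_leq_card/subsetP => y; rewrite !inE => /andP[-> /exists_inP[x xX yx]].
apply/exists_inP; exists x => //; rewrite /comparable_by /half_lt yx andbT.
by rewrite eq_sym; case: eqP => //= _; rewrite orbT.
Qed.

(** The shade of the non-neighbours [Y] of [X] misses [X], so the downward bound for [Y] gives the
    upward one for [X]. *)
Lemma half_matching_up k d : n <= k.*2 -> k + d <= n ->
  normalized_matching_graph (level k) (level (k + d)) (comparable_by half_lt).
Proof.
move=> k_ge kd; apply: normalized_matching_graph_nat.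
- by rewrite -card_gt0 level_gt0 //; lia.
- by rewrite -card_gt0 level_gt0 //; lia.
move=> X XL; set G := neighbours _ _ _; pose Y := level (k + d) :\: G.
have := card_shade k_ge kd (subsetDl _ G : Y \subset _).
have : #|shade k Y| + #|X| <= #|level k|.
  rewrite -cardsUI (_ : _ :&: _ = set0) ?cards0 ?addn0.
    by apply/subset_leq_card/subUsetP; split=> //; apply/subsetP => x; rewrite inE => /andP[].
  apply/setP => x; rewrite in_set0; apply/negP; rewrite inE => /andP[+ xX].
  rewrite inE => /andP[_ /exists_inP[y]]; rewrite !inE => /andP[+ yk] xy.
  rewrite yk => /negP[]; apply/exists_inP; exists x => //.
  by rewrite /comparable_by /half_lt xy andbT; case: eqP.
have : #|G| + #|Y| = #|level (k + d)|.
  have GL : G \subset level (k + d) by apply/subsetP => y; rewrite inE => /andP[].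
  by rewrite -(cardsID G (level (k + d))) (setIidPr GL).
by move: #|G| #|X| #|Y| #|level k| #|level _| #|shade _ _| => *; nia.
Qed.

Lemma half_normalized_matching : normalized_matching_property half_lt.
Proof.
(* Sizes run from [uphalf n] to [n], which makes [n./2 + 1] levels. *)
exists n./2, (fun i => level (uphalf n + i)); split; last first.
  move=> i j ij; have := ltn_ord i; have := ltn_ord j.
  have [ltij|ltji|eqij] := ltngtP i j; last by move: ij; rewrite -val_eqE /= eqij eqxx.
    by rewrite -(subnKC (ltnW ltij)) addnA => *; apply: half_matching_up; lia.
  by rewrite -(subnKC (ltnW ltji)) addnA => *; apply: half_matching_down; lia.
split.
- by move=> i; rewrite -card_gt0; apply: level_gt0; have := ltn_ord i; lia.
- move=> i j ij; rewrite -setI_eq0; apply/eqP/setP => x; rewrite !inE.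
  apply/negP => /andP[/eqP-> /eqP/addnI ij']; move: ij.
  by rewrite -val_eqE /= ij' eqxx.
- apply/setP => x; rewrite inE; apply/bigcupP.
  have xn : #|val x| <= n by have := max_card (mem (val x)); rewrite card_ord.
  have xge : n <= #|val x|.*2 := upper_halfP x.
  have xi : #|val x| - uphalf n < (n./2).+1 by lia.
  have cx : uphalf n <= #|val x| by lia.
  by exists (Ordinal xi); rewrite ?inE //; apply/eqP/esym; exact: subnKC cx.
- apply/setP => x; rewrite !inE addn0; apply/eqP/forallP => [xc y|x_min].
    by apply/negP => /half_lt_card; have := upper_halfP y; lia.
  apply/eqP; apply: contraT => xc; have [|y /half_step_lt yx] := @half_step_exists x.
    by have := upper_halfP x; move: xc; rewrite neq_ltn; lia.
  by have := x_min y; rewrite yx.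
move=> i x y; rewrite inE => /eqP xi /half_covers/half_stepP[_ _ yx].
have yn : #|val y| <= n by have := max_card (mem (val y)); rewrite card_ord.
have ij : i.+1 < (n./2).+1 by move: yn; rewrite yx xi; lia.
by exists (Ordinal ij) => //; rewrite inE yx xi -addnS.
Qed.

End HalfOrder.

Theorem theorem1p1 (n : nat) (n_gt0 : (0 < n)%N) :
  exists (p : upper_half n -> lower_half n) (lt : rel (upper_half n)),
    bijective p /\ strict_partial_order lt /\
    (forall x y : upper_half n, lt y x -> val y \proper val x) /\
    (forall C : {set upper_half n}, is_chain lt C ->
       rank_symmetric_chain
         ([set val x | x in C] :|: [set val (p x) | x in C])) /\
    normalized_matching_property lt.
Proof.
case: n n_gt0 => // N _; exists (@half_map N), (@half_lt N); do !split.
- exact: half_map_bij.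
- exact: (half_lt_strict_partial_order N).1.
- exact: (half_lt_strict_partial_order N).2.
- by move=> x y; apply: half_lt_proper.
- exact: half_rank_symmetric_chain.
- exact: half_normalized_matching.
Qed.
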